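(* Let $n\in\mathbb{N}$ and $m\geq 3$. Then \[ B_n(d_1,d_2,\dots, d_n)= n!\cdot e_{m+2,n}, \] where $d_j=-(j-1)!\cdot \sigma'_m(j)$ for $j\ge1$.
   Context: The complete exponential Bell polynomials $B_n(x_1,\dots,x_n)$ are defined by $\exp\big(\sum_{j\ge1}x_j\frac{t^j}{j!}\big)=\sum_{n\ge0}B_n(x_1,\dots,x_n)\frac{t^n}{n!}$. For $m\ge3$ and $j\in\mathbb{N}$, $\sigma'_m(j)$ is the sum of the positive divisors $d$ of $j$ with $d\equiv 0$, $1$ or $m-1 \pmod m$. For $g\ge5$ and $n\in\mathbb{N}_0$, $e_{g,n}=1$ if $n=0$, $e_{g,n}=(-1)^k$ if $n=P_{g,k}$ or $n=Q_{g,k}$ for some $k\in\mathbb{N}$ (where $P_{g,k}=\frac{k((g-2)k-(g-4))}{2}$, $Q_{g,k}=\frac{k((g-2)k+(g-4))}{2}$), and $e_{g,n}=0$ otherwise. *)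

(* Defs.v *)
From HB Require Import structures.
From mathcomp Require Import all_boot all_order all_algebra.
Set Implicit Arguments. Unset Strict Implicit. Unset Printing Implicit Defensive.
Import Order.TTheory GRing.Theory Num.Theory.

(* Complete exponential Bell polynomial B_n(x_1,...,x_n) over the rationals,
   defined as n! times the coefficient of t^n in exp(sum_{j>=1} x_j t^j/j!).
   Since f := sum_{j=1}^n x_j t^j / j! has no constant term, the coefficient
   of t^n in exp(f) equals that of the finite sum sum_{k=0}^n f^k / k!
   (terms with j > n or k > n cannot contribute to t^n). *)
Local Open Scope ring_scope.

Definition bell_f (n : nat) (x : nat -> rat) : {poly rat} :=
  \sum_(1 <= j < n.+1) (x j / (j`!)%:R) *: 'X^j.

Definition bellB (n : nat) (x : nat -> rat) : rat :=
  (n`!)%:R * (\sum_(k < n.+1) ((k`!)%:R)^-1 *: (bell_f n x) ^+ k)`_n.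

Local Close Scope ring_scope.

Definition sigma' (m j : nat) : nat :=
  \sum_(d < j.+1 | (0 < d) && (d %| j) &&
                   [|| d %% m == 0, d %% m == 1 | d %% m == (m - 1) %% m]) d.

(* generalized polygonal numbers P_{g,k}, Q_{g,k} (the products are even,
   and (g-2)k >= g-4 for k >= 1, so no truncation occurs) *)
Definition Pgk (g k : nat) : nat := (k * ((g - 2) * k - (g - 4))) %/ 2.
Definition Qgk (g k : nat) : nat := (k * ((g - 2) * k + (g - 4))) %/ 2.

(* e_{g,n}: 1 if n = 0; (-1)^k if n = P_{g,k} or Q_{g,k} for some k >= 1;
   0 otherwise.  Any such k satisfies k <= n (as P_{g,k}, Q_{g,k} >= k
   for g >= 5), so we search k among 1..n. *)
Definition e_gn (g n : nat) : int :=
  if n == 0 then 1%R else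
  match [pick k : 'I_n.+1 | (0 < k) && ((n == Pgk g k) || (n == Qgk g k))] with
  | Some k => ((-1) ^+ k)%R
  | None => 0%R
  end.

Definition dseq (m : nat) (j : nat) : rat :=
  (- ((j.-1)`!)%:R * (sigma' m j)%:R)%R.

(* Main.v *)
(* Both exp(f), with f = sum_j d_j t^j / j!, and the product of the factors
   1 - t^d over the d congruent to 0, 1 or -1 mod m have constant term 1 and
   satisfy t p' = - p S with S = sum_j sigma'_m(j) t^j, which determines a power
   series; hence they coincide.  The Jacobi triple product identity expands the
   product as the theta series with coefficients e_{m+2,n}.  The identity is
   reached from its finite form, a case of the q-binomial theorem, since
   (q)_n times a Gaussian binomial far from the borders tends to 1.  All series
   are polynomials modulo a power of 'X. *)
Require Import Defs.
From mathcomp Require Import all_boot all_order all_algebra.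
From mathcomp Require Import zify ring.
Set Implicit Arguments. Unset Strict Implicit. Unset Printing Implicit Defensive.
Import GRing.Theory.
Local Open Scope ring_scope.

(** * Gaussian binomials and the q-binomial theorem *)

Fixpoint qbin (R : nzRingType) (q : R) (n k : nat) : R :=
  match n, k with
  | _, 0 => 1
  | 0, _.+1 => 0
  | n'.+1, k'.+1 => q ^+ k * qbin q n' k + qbin q n' k'
  end.

(** The q-Pochhammer symbol (q; q)_n, written (q)_n below. *)
Definition qfact (R : nzRingType) (q : R) (n : nat) : R :=
  \prod_(i < n) (1 - q ^+ i.+1).

Section GaussianBinomial.
Variables (R : comNzRingType) (q : R).

Lemma qbin0 n : qbin q n 0 = 1. Proof. by case: n. Qed.

Lemma qbinS n k :
  qbin q n.+1 k.+1 = q ^+ k.+1 * qbin q n k.+1 + qbin q n k.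
Proof. by []. Qed.

Lemma qbin_small n k : (n < k)%N -> qbin q n k = 0.
Proof.
elim: n k => [|n IHn] [|k] //= lt_nk.
by rewrite !IHn ?mulr0 ?addr0 // ltnW.
Qed.

Lemma qbin_id n : qbin q n n = 1.
Proof. by elim: n => //= n ->; rewrite qbin_small // mulr0 add0r. Qed.

Lemma qfactS n : qfact q n.+1 = qfact q n * (1 - q ^+ n.+1).
Proof. by rewrite /qfact big_ord_recr. Qed.

(** By double induction: the two terms of the q-Pascal rule contribute the summands of 1 - q^(k+l+2)
    = q^(k+1) (1 - q^(l+1)) + (1 - q^(k+1)). *)
Lemma qbin_fact k l :
  qfact q k * qfact q l * qbin q (k + l) k = qfact q (k + l).
Proof.
elim: k l => [|k IHk] l; first by rewrite qbin0 /qfact big_ord0 mul1r mulr1.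
elim: l => [|l IHl].
  by rewrite addn0 qbin_id /qfact big_ord0 !mulr1.
have IHk' := IHk l.+1.
have ->: qfact q (k.+1 + l.+1)
  = qfact q (k.+1 + l) * (1 - q ^+ k.+1 * q ^+ l.+1).
  by rewrite -exprD addnS qfactS.
rewrite addSn qbinS -IHl mulrDr.
have ->: qfact q k.+1 * qfact q l.+1 * qbin q (k + l.+1) k
  = (1 - q ^+ k.+1) * qfact q (k.+1 + l).
  by rewrite addSnnS -IHk' (qfactS k); ring.
by rewrite -IHl addSnnS (qfactS l); ring.
Qed.

(** The q-binomial theorem. Without its factor at i = 0 the product is the same one for y q in place
    of y, so the induction leaves y free. *)
Lemma qbin_prod (a y : R) n :
  \prod_(i < n) (a + y * q ^+ i) =
  \sum_(k < n.+1) qbin q n k * q ^+ 'C(k, 2) * y ^+ k * a ^+ (n - k).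
Proof.
elim: n y => [|n IHn] y; first by rewrite big_ord0 big_ord1 /= !mulr1.
rewrite big_ord_recl expr0 mulr1.
under eq_bigr => i _ do rewrite /= /bump /= add1n exprS mulrA.
rewrite IHn mulrDl !mulr_sumr.
rewrite [in RHS]big_ord_recl /= subn0 bin0n !mulr1.
under [in RHS]eq_bigr => k _.
  rewrite /bump /= add1n subSS !mulrDl binS bin1.
  over.
rewrite big_split /= addrA; congr (_ + _); last first.
  by apply: eq_bigr => k _; rewrite !exprMn exprD !exprS; ring.
(* The sum over k < n is extended by the term k = n, which vanishes with [qbin q n n.+1], to reach
   the range of the right-hand side. *)
rewrite big_ord_recl [X in _ + X = _](_ : _ = 
   \sum_(k < n.+1) a * (qbin q n k.+1 * q ^+ 'C(k.+1, 2) * (y * q) ^+ k.+1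
     * a ^+ (n - k.+1))); last first.
  by rewrite big_ord_recr /= qbin_small // !mul0r mulr0 addr0.
rewrite /= qbin0 bin0n subn0 !expr0 !mulr1 !mul1r -exprS; congr (_ + _).
apply: eq_bigr => k _; have:= ltn_ord k; rewrite ltnS leq_eqVlt => /orP[/eqP->|lt_kn].
  by rewrite qbin_small // !(mul0r, mulr0).
rewrite binS bin1 !exprMn !exprD.
have ->: (n - k = (n - k.+1).+1)%N by lia.
by rewrite !exprS; ring.
Qed.

End GaussianBinomial.

(** * Polygonal numbers and the finite form of the triple product *)

Lemma big_nat_centered (V : nmodType) n (F : nat -> V) :
  \sum_(k < n.*2.+1) F k =
  F n + \sum_(1 <= j < n.+1) (F (n + j)%N + F (n - j)%N).
Proof.
rewrite -(big_mkord xpredT) (@big_cat_nat _ _ _ n) //=; last by lia.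
rewrite (@big_ltn _ _ _ n) ; last by lia.
rewrite big_split /= addrCA; congr (_ + _); rewrite addrC; congr (_ + _).
  rewrite -[n.+1 in LHS]add1n big_addn.
  have -> : (n.*2.+1 - n = n.+1)%N by lia.
  by apply: eq_bigr => i _; rewrite addnC.
by rewrite big_nat_rev [RHS]big_add1.
Qed.

(** A form free of division and truncated subtraction, suited to the exponents ['C(k, 2)] of the
    q-binomial theorem at q = x^m. *)
Lemma PgkE m k : (2 <= m)%N -> Pgk (m + 2) k = (m * 'C(k, 2) + k)%N.
Proof.
move=> hm; rewrite /Pgk; case: k => [|k]; first by rewrite mul0n muln0.
have := mul_bin_diag k.+1 1; rewrite /= bin1 => eC.
rewrite [X in (X %/ 2)%N](_ : _ = (m * 'C(k.+1, 2) + k.+1) * 2)%N ?mulnK //.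
rewrite [RHS]mulnDl -mulnA [('C(_, _) * 2)%N]mulnC -eC /=.
have ->: ((m + 2 - 2) * k.+1 - (m + 2 - 4) = m * k + 2)%N by nia.
nia.
Qed.

Lemma QgkE m k : (2 <= m)%N -> Qgk (m + 2) k = (Pgk (m + 2) k + (m - 2) * k)%N.
Proof.
move=> hm; rewrite PgkE // /Qgk; case: k => [|k]; first by rewrite mul0n !muln0.
have := mul_bin_diag k.+1 1; rewrite /= bin1 => eC.
rewrite [X in (X %/ 2)%N](_ : _ = (m * 'C(k.+1, 2) + k.+1 + (m - 2) * k.+1) * 2)%N ?mulnK //.
have eCm : (m * 'C(k.+1, 2) * 2 = m * (k.+1 * k))%N.
  by rewrite -mulnA [('C(_, _) * 2)%N]mulnC -eC.
nia.
Qed.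

(** With [QgkE] this gives P_k <= Q_k < P_(k+1): the pairs do not overlap, hence a value determines
    its index. *)
Lemma PgkS m k : (2 <= m)%N ->
  Pgk (m + 2) k.+1 = (Qgk (m + 2) k + k.*2.+1)%N.
Proof. by move=> hm; rewrite QgkE // !PgkE // binS bin1; nia. Qed.

Lemma leq_Pgk m j k : (2 <= m)%N -> (j <= k)%N ->
  (Pgk (m + 2) j <= Pgk (m + 2) k)%N.
Proof.
move=> hm; elim: k => [|k IHk]; first by rewrite leqn0 => /eqP->.
rewrite leq_eqVlt => /orP[/eqP-> //|/IHk]; rewrite PgkS // QgkE //.
by lia.
Qed.

Lemma Qgk_lt_Pgk m j k : (2 <= m)%N -> (j < k)%N ->
  (Qgk (m + 2) j < Pgk (m + 2) k)%N.
Proof. by move=> hm /(leq_Pgk hm); rewrite PgkS //; lia. Qed.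

Lemma polygonal_index_inj m j k N : (2 <= m)%N ->
  (N == Pgk (m + 2) j) || (N == Qgk (m + 2) j) ->
  (N == Pgk (m + 2) k) || (N == Qgk (m + 2) k) -> j = k.
Proof.
move=> hm hj hk; have lePQ i : (Pgk (m + 2) i <= Qgk (m + 2) i)%N by rewrite QgkE // leq_addr.
have := lePQ j; have := lePQ k.
by case: (ltngtP j k) => // /(Qgk_lt_Pgk hm); lia.
Qed.

(* Obtained from [qbin_prod] at base x^m by substituting a = x^(m n), y = - x
   and cancelling (-1)^n x^c. *)
Lemma finite_triple_product m n : (2 <= m)%N ->
  \prod_(i < n) ((1 - 'X^((m * i).+1)) * (1 - 'X^(m * i + m.-1))) =
  qbin 'X^m n.*2 n + \sum_(1 <= j < n.+1)
    (-1) ^+ j * (qbin 'X^m n.*2 (n + j) * 'X^(Pgk (m + 2) j) +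
                 qbin 'X^m n.*2 (n - j) * 'X^(Qgk (m + 2) j)) :> {poly rat}.
Proof.
move=> hm.
(* [c] is the power of x carried by the central term k = n of the q-binomial expansion. *)
set c := (m * n * n + n + m * 'C(n, 2))%N.
have nz : (-1) ^+ n * 'X^c != 0 :> {poly rat}.
  by rewrite mulf_neq0 ?signr_eq0 // monic_neq0 ?monicXn.
apply: (mulfI nz).
have expC (k e : nat) : (m * 'C(k, 2) + k + m * n * (n.*2 - k) = c + e)%N ->
    qbin 'X^m n.*2 k * ('X^m) ^+ 'C(k, 2) * (- 'X) ^+ k * 'X^(m * n) ^+ (n.*2 - k)
    = (-1) ^+ k * 'X^c * (qbin 'X^m n.*2 k * 'X^e) :> {poly rat}.
  move=> h; rewrite (exprNn 'X k) -!exprM.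
  have ->: (-1) ^+ k * 'X^c * (qbin 'X^m n.*2 k * 'X^e)
     = (-1) ^+ k * qbin 'X^m n.*2 k * 'X^(c + e) :> {poly rat}.
    by rewrite exprD; ring.
  by rewrite -h !exprD; ring.
have bin2D k l : 'C(k + l, 2) = ('C(k, 2) + 'C(l, 2) + k * l)%N.
  elim: l => [|l IHl]; first by rewrite addn0 muln0 !addn0.
  by rewrite addnS !binS !bin1 IHl mulnS; lia.
have bin2M k : ('C(k, 2) * 2 + k = k * k)%N.
  by elim: k => // k IHk; rewrite binS bin1 mulnS mulSn; lia.
transitivity (\prod_(i < n.*2) ('X^(m * n) + (- 'X) * ('X^m) ^+ i) : {poly rat}).
  rewrite -addnn big_split_ord /= big_split /=.
  have ->: \prod_(i < n) ('X^(m * n) + (- 'X) * ('X^m) ^+ (n + i)) =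
      'X^(m * n * n) * \prod_(i < n) (1 - 'X^((m * i).+1)) :> {poly rat}.
    rewrite [in RHS]exprM -[X in _ ^+ X * _]card_ord -prodr_const -big_split /=.
    by apply: eq_bigr => i _; rewrite -exprM mulnDr exprS exprD; ring.
  have ->: \prod_(i < n) ('X^(m * n) + (- 'X) * ('X^m) ^+ i) =
      (-1) ^+ n * 'X^(n + m * 'C(n, 2)) *
      \prod_(i < n) (1 - 'X^(m * i + m.-1)) :> {poly rat}.
    have ->: (-1) ^+ n * 'X^(n + m * 'C(n, 2)) =
        \prod_(i < n) (- 'X^((m * i).+1)) :> {poly rat}.
      elim: (n) => [|k IHk]; first by rewrite big_ord0 muln0 mulr1.
      have e : (k.+1 + m * 'C(k.+1, 2) = k + m * 'C(k, 2) + (m * k).+1)%N.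
        by rewrite binS bin1; lia.
      by rewrite big_ord_recr /= -IHk e [in LHS]exprD (exprS (-1)); ring.
    (* The product is reversed because x^(m n) - x^(m i + 1) = - x^(m i + 1) (1 - x^(m (n - i - 1) +
       m - 1)). *)
    rewrite [X in _ = _ * X](reindex_inj rev_ord_inj) -big_split /=.
    apply: eq_bigr => i _; have := ltn_ord i => lt_in.
    have ->: (m * n = (m * i).+1 + (m * (n - i.+1) + m.-1))%N by nia.
    by rewrite exprD -exprM exprS; ring.
  by rewrite /c !exprD; ring.
(* Once the sum is centred at n, the index n + j yields the exponent P_j and n - j yields Q_j. *)
rewrite qbin_prod (big_nat_centered n (fun k => qbin 'X^m n.*2 k *
  ('X^m) ^+ 'C(k, 2) * (- 'X) ^+ k * 'X^(m * n) ^+ (n.*2 - k))).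
rewrite [RHS]mulrDr mulr_sumr; congr (_ + _).
  by rewrite (expC n 0%N) ?expr0 ?mulr1 // /c -addnn addnK; ring.
apply: eq_big_nat => j /andP[j_gt0 le_jn].
have PE := PgkE j hm; have QE := QgkE j hm.
have [l def_n] : {l | n = l + j}%N by exists (n - j)%N; rewrite subnK.
have subl : (n - j = l)%N by rewrite def_n addnK.
rewrite (expC (n + j)%N (Pgk (m + 2) j)); last first.
  have -> : (n.*2 - (n + j) = l)%N by lia.
  rewrite PE /c bin2D {subl nz expC PE QE c}; move: 'C(n, 2) 'C(j, 2) => u v.
  by rewrite -(mulnA m n n) -(mulnA m n l) [in X in (_ = m * X + _ + _ + _)%N]def_n; lia.
rewrite (expC (n - j)%N (Qgk (m + 2) j)); last first.
  rewrite subl; have -> : (n.*2 - l = n + j)%N by lia.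
  have := bin2M j; rewrite QE PE /c def_n bin2D; move: 'C(l, 2) 'C(j, 2) => u v.
  move/(congr1 (muln m)); have: ((m - 2) * j + j * 2 = m * j)%N.
    by rewrite [(j * 2)%N]mulnC -mulnDl subnK.
  move: ((m - 2) * j)%N => w; rewrite !(mulnDr, mulnDl, mulnA); lia.
have ->: (-1) ^+ (n - j) = (-1) ^+ n * (-1) ^+ j :> {poly rat}.
  by rewrite -signr_odd oddB // signr_addb !signr_odd.
by rewrite exprD; ring.
Qed.

(** * Congruence modulo a power of the indeterminate *)

Definition eqmodX (N : nat) (p q : {poly rat}) : bool := 'X^N %| p - q.

Section EqmodX.
Variable N : nat.
Implicit Types p q r s : {poly rat}.

Lemma eqmodX_refl p : eqmodX N p p.
Proof. by rewrite /eqmodX subrr dvdp0. Qed.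

Lemma eqmodX_sym p q : eqmodX N p q -> eqmodX N q p.
Proof. by rewrite /eqmodX -opprB dvdpNr. Qed.

Lemma eqmodX_trans q p r : eqmodX N p q -> eqmodX N q r -> eqmodX N p r.
Proof.
rewrite /eqmodX => pq qr.
by rewrite -[p - r](subrKA q) dvdp_add.
Qed.

Lemma eqmodXD p q r s : eqmodX N p q -> eqmodX N r s -> eqmodX N (p + r) (q + s).
Proof. by rewrite /eqmodX opprD addrACA; exact: dvdp_add. Qed.

Lemma eqmodXM p q r s : eqmodX N p q -> eqmodX N r s -> eqmodX N (p * r) (q * s).
Proof.
rewrite /eqmodX => pq rs.
have -> : p * r - q * s = (p - q) * r + q * (r - s) by ring.
by apply: dvdp_add; [exact: dvdp_mulr | exact: dvdp_mull].
Qed.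

Lemma eqmodXMl r p q : eqmodX N p q -> eqmodX N (r * p) (r * q).
Proof. by apply: eqmodXM; exact: eqmodX_refl. Qed.

Lemma eqmodX_sum (I : Type) (t : seq I) (P : pred I) (F G : I -> {poly rat}) :
  (forall i, P i -> eqmodX N (F i) (G i)) ->
  eqmodX N (\sum_(i <- t | P i) F i) (\sum_(i <- t | P i) G i).
Proof.
move=> FG; apply: (big_ind2 (eqmodX N)) => //; first exact: eqmodX_refl.
by move=> p q r s pq rs; exact: eqmodXD pq rs.
Qed.

Lemma eqmodX_exp0 d : (N <= d)%N -> eqmodX N 'X^d 0.
Proof. by move=> led; rewrite /eqmodX subr0 dvdp_exp2l. Qed.

Lemma eqmodX_coef p q i : (i < N)%N -> eqmodX N p q -> p`_i = q`_i.
Proof.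
move=> lti /dvdpP[r e]; apply/eqP; rewrite -subr_eq0 -coefB e coefMXn lti.
by [].
Qed.

(** A nonzero constant term makes r coprime to X, hence to X^N. *)
Lemma eqmodX_cancel r p q : r`_0 != 0 ->
  eqmodX N (r * p) (r * q) -> eqmodX N p q.
Proof.
move=> r0; rewrite /eqmodX -mulrBr Gauss_dvdpr // coprimep_expl //.
by rewrite coprimep_sym coprimepX -horner_coef0 in r0 *.
Qed.

End EqmodX.

(** * Passage to the limit: the Jacobi triple product *)

Lemma qfact_coef0 m k : (0 < m)%N -> (qfact 'X^m k : {poly rat})`_0 = 1.
Proof.
move=> m_gt0; rewrite -horner_coef0 horner_prod big1 // => i _.
by rewrite !hornerE -exprM expr0n muln_eq0 /= orbF eqn0Ngt m_gt0 subr0.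
Qed.

(** Each factor beyond the first N is 1 - x^(m i) with m i > N, hence congruent to 1. *)
Lemma qfact_stable m N k l : (0 < m)%N -> (N <= k)%N -> (N <= l)%N ->
  eqmodX N.+1 (qfact 'X^m k) (qfact 'X^m l).
Proof.
move=> m_gt0 leNk leNl.
suff H i : (N <= i)%N -> eqmodX N.+1 (qfact 'X^m i) (qfact 'X^m N).
  by apply: eqmodX_trans (H k leNk) _; apply: eqmodX_sym; exact: H.
move=> /subnK <-; elim: (i - N)%N => [|d IHd]; first exact: eqmodX_refl.
rewrite addSn qfactS -[X in eqmodX _ _ X]mulr1; apply: eqmodXM IHd _.
rewrite /eqmodX addrC addKr dvdpNr -exprM dvdp_exp2l //; nia.
Qed.

(** Up to degree N all (q)_i with i >= N agree, so (q)_n (q)_(k+l) / ((q)_k (q)_l) is 1; multiplying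
    by (q)_l avoids the division. *)
Lemma qbin_limit m N k l n : (0 < m)%N -> (N <= k)%N -> (N <= l)%N -> (N <= n)%N ->
  eqmodX N.+1 (qfact 'X^m n * qbin 'X^m (k + l) k) 1.
Proof.
move=> m_gt0 leNk leNl leNn.
apply: (@eqmodX_cancel _ (qfact 'X^m l)); first by rewrite qfact_coef0 ?oner_eq0.
apply: (@eqmodX_trans _ (qfact 'X^m k * qfact 'X^m l * qbin 'X^m (k + l) k)).
  rewrite mulrA [X in eqmodX _ (X * _)]mulrC; apply: eqmodXM; last exact: eqmodX_refl.
  by apply: eqmodXM; [exact: qfact_stable | exact: eqmodX_refl].
by rewrite qbin_fact mulr1 qfact_stable // (leq_trans leNk) ?leq_addr.
Qed.

Lemma coef_eqmodX N (p q : {poly rat}) : (forall i, (i < N)%N -> p`_i = q`_i) -> eqmodX N p q.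
Proof.
move=> epq; rewrite /eqmodX -[p - q](poly_take_drop N) dvdp_addl.
  suff -> : take_poly N (p - q) = 0 by rewrite dvdp0.
  apply/polyP => i; rewrite coef_take_poly coef0; case: ifP => // lti.
  by rewrite coefB epq // subrr.
by rewrite dvdp_mull.
Qed.

Definition triple_prod (m n : nat) : {poly rat} :=
  \prod_(i < n) ((1 - 'X^((m * i).+1)) * (1 - 'X^(m * i + m.-1)) *
                 (1 - 'X^(m * i.+1))).

(** With 2 N blocks the Gaussian binomials are those of 4 N over 2 N + j and 2 N - j, at distance at
    least N from the borders when j <= N. For j > N both polygonal exponents exceed N and the terms
    vanish. *)
Lemma triple_prod_theta m N : (2 <= m)%N ->
  eqmodX N.+1 (triple_prod m N.*2)
    (1 + \sum_(1 <= j < N.*2.+1)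
           (-1) ^+ j * ('X^(Pgk (m + 2) j) + 'X^(Qgk (m + 2) j))).
Proof.
move=> hm; have m_gt0 : (0 < m)%N by exact: ltn_trans hm.
have -> : triple_prod m N.*2 = qfact 'X^m N.*2 *
    \prod_(i < N.*2) ((1 - 'X^((m * i).+1)) * (1 - 'X^(m * i + m.-1))).
  rewrite /qfact -big_split; apply: eq_bigr => i _ /=.
  by rewrite -exprM mulrC.
rewrite finite_triple_product // mulrDr mulr_sumr; apply: eqmodXD.
  by rewrite -(addnn N.*2); apply: qbin_limit => //; lia.
rewrite !big_nat; apply: eqmodX_sum => j /andP[j_gt0 le_j].
rewrite mulrCA; apply: eqmodXMl; rewrite mulrDr !mulrA.
have leP : (j <= Pgk (m + 2) j)%N by rewrite PgkE // leq_addl.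
have leQ : (j <= Qgk (m + 2) j)%N by rewrite QgkE // (leq_trans leP) ?leq_addr.
have [le_jN | lt_Nj] := leqP j N.
  have limit k l : (k + l = N.*2 .*2)%N -> (N <= k)%N -> (N <= l)%N ->
      eqmodX N.+1 (qfact 'X^m N.*2 * qbin 'X^m N.*2.*2 k) 1.
    by move=> <- leNk leNl; apply: qbin_limit => //; lia.
  apply: eqmodXD; rewrite -[X in eqmodX _ _ X]mul1r;
    (apply: eqmodXM; last exact: eqmodX_refl).
    by apply: (limit _ (N.*2 - j)%N); lia.
  by apply: (limit _ (N.*2 + j)%N); lia.
have vanish k r : (j <= k)%N -> eqmodX N.+1 (r * 'X^k) 'X^k.
  move=> lejk; have X0 := eqmodX_exp0 (leq_trans lt_Nj lejk).
  apply: eqmodX_trans (eqmodX_sym X0); rewrite -[X in eqmodX _ _ X](mulr0 r).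
  exact: eqmodXMl.
by apply: eqmodXD; exact: vanish.
Qed.

Lemma triple_prod_coef m N : (3 <= m)%N -> (0 < N)%N ->
  (triple_prod m N.*2)`_N = (e_gn (m + 2) N)%:~R.
Proof.
move=> hm N_gt0; have hm2 : (2 <= m)%N by exact: ltnW.
rewrite (eqmodX_coef (ltnSn N) (triple_prod_theta N hm2)).
rewrite coefD coef1 gtn_eqF // add0r coef_sum.
have termE j : ((-1) ^+ j * ('X^(Pgk (m + 2) j) + 'X^(Qgk (m + 2) j)) : {poly rat})`_N
    = (-1) ^+ j * ((N == Pgk (m + 2) j)%:R + (N == Qgk (m + 2) j)%:R).
  by rewrite -signr_odd mulr_sign -[in RHS]signr_odd mulr_sign; case: odd;
     rewrite ?coefN coefD !coefXn.
under eq_bigr => j _ do rewrite termE.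
rewrite /e_gn gtn_eqF //; case: pickP => [k /andP[k_gt0 hk]|none].
  have lt_k := ltn_ord k.
  rewrite (bigD1_seq (k : nat)) ?mem_index_iota ?iota_uniq //=; last by lia.
  rewrite big1_seq ?addr0 => [|j /andP[neq_jk _]].
    have := QgkE k hm2 => eQ.
    (* P_k and Q_k differ by (m - 2) k, positive as m >= 3, so exactly one of the two indicators is
       1. *)
    have neqPQ : Pgk (m + 2) k != Qgk (m + 2) k by rewrite eQ; nia.
    rewrite rmorph_sign; case/orP: hk => /eqP eN; rewrite -eN in neqPQ *.
      by rewrite eqxx (negPf neqPQ) addr0 mulr1.
    by rewrite eqxx eq_sym (negPf neqPQ) add0r mulr1.
  suff /norP[/negPf-> /negPf->] : ~~ ((N == Pgk (m + 2) j) || (N == Qgk (m + 2) j)).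
    by rewrite addr0 mulr0.
  by apply: contra neq_jk => hj; rewrite (polygonal_index_inj hm2 hj hk).
rewrite big_nat big1 // => j /andP[j_gt0 _].
(* The search in [e_gn] stops at N; for larger j both polygonal numbers are at least j > N. *)
have [le_jN | lt_Nj] := leqP j N.
  have := none (Ordinal (le_jN : (j < N.+1)%N)); rewrite /= j_gt0 /=.
  by case/norP => /negPf-> /negPf->; rewrite addr0 mulr0.
have leP : (j <= Pgk (m + 2) j)%N by rewrite PgkE // leq_addl.
have leQ : (j <= Qgk (m + 2) j)%N by rewrite QgkE // (leq_trans leP) ?leq_addr.
by rewrite !ltn_eqF ?addr0 ?mulr0 // (leq_trans lt_Nj).
Qed.

(** * Logarithmic derivatives and the divisor sums *)

(** A division-free form of - x p' / p = S up to degree N, turning products of p into sums of S. *)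
Definition log_deriv (N : nat) (S p : {poly rat}) : bool :=
  eqmodX N.+1 ('X * p^`()) (- (p * S)).

Lemma log_derivM N (S T p q : {poly rat}) :
  log_deriv N S p -> log_deriv N T q -> log_deriv N (S + T) (p * q).
Proof.
rewrite /log_deriv derivM mulrDr => hp hq.
have -> : - (p * q * (S + T)) = q * - (p * S) + p * - (q * T) by ring.
have -> : 'X * (p^`() * q) = q * ('X * p^`()) by ring.
have -> : 'X * (p * q^`()) = p * ('X * q^`()) by ring.
by apply: eqmodXD; exact: eqmodXMl.
Qed.

Lemma log_deriv_prod N n (S F : nat -> {poly rat}) :
  (forall i, log_deriv N (S i) (F i)) ->
  log_deriv N (\sum_(i < n) S i) (\prod_(i < n) F i).
Proof.
move=> hF; elim: n => [|n IHn].
  by rewrite !big_ord0 /log_deriv derivC !mulr0 oppr0 eqmodX_refl.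
by rewrite !big_ord_recr; exact: log_derivM.
Qed.

(* As S has no constant term, the coefficient of t^i in t p' = - p S expresses
   i p_i through the p_j with j < i. *)
Lemma log_deriv_coef_inj N (S p q : {poly rat}) : S`_0 = 0 -> p`_0 = q`_0 ->
  log_deriv N S p -> log_deriv N S q -> forall i, (i <= N)%N -> p`_i = q`_i.
Proof.
move=> S0 pq0 hp hq; elim/ltn_ind => -[|i] IHi le_iN //.
have nz : i.+1%:R != 0 :> rat by rewrite Num.Theory.pnatr_eq0.
apply: (mulfI nz).
have coefE r : log_deriv N S r ->
    i.+1%:R * r`_i.+1 = - \sum_(j < i.+1) r`_j * S`_(i.+1 - j).
  move=> hr; have := eqmodX_coef (i := i.+1) (N := N.+1) le_iN hr.
  rewrite coefXM coef_deriv mulr_natl /= => ->.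
  by rewrite coefN coefM big_ord_recr /= subnn S0 mulr0 addr0.
rewrite !coefE //; congr (- _); apply: eq_bigr => j _.
by rewrite IHi // (leq_trans (ltnW (ltn_ord j))).
Qed.

(** The truncation of d x^d / (1 - x^d); the index 0 has to be excluded because d divides 0. *)
Definition multiples_poly (N d : nat) : {poly rat} :=
  \poly_(j < N.+1) (if (0 < j)%N && (d %| j)%N then d%:R else 0).

(** Multiplication by 1 - x^d telescopes the series of multiples, of which only d x^d survives. *)
Lemma log_deriv_subXn N d : (0 < d)%N ->
  log_deriv N (multiples_poly N d) (1 - 'X^d).
Proof.
move=> d_gt0; apply: coef_eqmodX => i lt_i.
rewrite coefN mulrBl mul1r coefB coefXnM derivB derivXn derivC sub0r.
rewrite mulrN coefN mulrnAr -exprS prednK // coefMn coefXn; congr (- _).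
rewrite !coef_poly lt_i.
have [lt_id | lt_di | ->] := ltngtP i d.
- rewrite subr0 mul0rn; case: ifP => // /andP[i_gt0 /(dvdn_leq i_gt0)].
  by rewrite leqNgt lt_id.
- rewrite subn_gt0 lt_di (ltn_trans d_gt0 lt_di) (leq_ltn_trans (leq_subr _ _) lt_i).
  by rewrite dvdn_subl ?dvdnn ?(ltnW lt_di) // subrr mul0rn.
- by rewrite d_gt0 dvdnn subnn /= subr0.
Qed.

(** The integers 1, ..., m n form n blocks of length m; in each, the admissible residues sit at the
    first and the last two places, distinct since m >= 3. *)
Lemma sigma'_triple m n j : (3 <= m)%N -> (0 < j <= m * n)%N ->
  let D d := if (d %| j)%N then d else 0%N in
  sigma' m j = (\sum_(i < n) (D (m * i).+1 + D (m * i + m.-1) + D (m * i.+1)))%N.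
Proof.
move=> hm /andP[j_gt0 le_j] D.
pose good d := [|| d %% m == 0, d %% m == 1 | d %% m == (m - 1) %% m]%N.
(* The range d <= j grows to d <= m n, where no new d divides j, and is shifted by d = e + 1. *)
have -> : sigma' m j = (\sum_(0 <= e < n * m | good e.+1) D e.+1)%N.
  rewrite /sigma' -(big_mkord (fun d => (0 < d)%N && (d %| j)%N && good d) id).
  rewrite (@big_nat_widen _ _ _ _ _ (n * m).+1); last by rewrite ltnS mulnC.
  rewrite big_ltn_cond //= big_add1 /= big_mkcond [RHS]big_mkcond /=.
  apply: eq_bigr => e _; rewrite /D ltnS.
  case: good; rewrite ?andbF ?andbT //; case: (boolP (_ %| j)%N) => //= dvd_ej.
  by rewrite (dvdn_leq j_gt0 dvd_ej).
elim: n {le_j} => [|n IHn]; first by rewrite big_geq // big_ord0.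
rewrite mulSn addnC (@big_cat_nat _ _ _ (n * m)) ?leq_addr //= IHn.
rewrite [RHS]big_ord_recr /=; congr (_ + _)%N.
rewrite -[X in \sum_(X <= _ < _ | _) _]add0n big_addn addnC addnK big_mkcond /=.
have goodE i : (i < m)%N ->
    good (i + n * m).+1 = [|| i.+1 == m, i == 0%N | i.+2 == m].
  move=> lt_im; rewrite /good -addSn addnC modnMDl (@modn_small (m - 1)); last by lia.
  move: lt_im; rewrite leq_eqVlt => /orP[/eqP->|lt_im]; first by rewrite modnn !eqxx.
  by rewrite modn_small //; lia.
under eq_big_nat => i /andP[_ lt_im] do rewrite goodE //.
have [k def_m] : {k | m = k.+3} by exists (m - 3)%N; lia.
rewrite def_m in hm * => {goodE IHn good}.
rewrite big_nat_recl // big_nat_recr //= big_nat_recr //= big_nat big1 => [|i /andP[_ lt_ik]].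
  rewrite !eqxx !orbT /=. rewrite [X in _ + (X + _)]add0r addrA; congr (D _ + D _ + D _)%N; lia.
by rewrite ifF //; lia.
Qed.

Lemma sigma'0 m : sigma' m 0 = 0%N.
Proof. by rewrite /sigma' big_pred0 // => d; rewrite ord1. Qed.

Definition sigma_poly (m N : nat) : {poly rat} :=
  \poly_(j < N.+1) (sigma' m j)%:R.

(** The contributions of the factors add up to the divisor sums; N <= m n ensures that no divisor is
    missed up to degree N. *)
Lemma log_deriv_triple_prod m n N : (3 <= m)%N -> (N <= m * n)%N ->
  log_deriv N (sigma_poly m N) (triple_prod m n).
Proof.
move=> hm leN; set s := multiples_poly N.
have -> : sigma_poly m N =
    \sum_(i < n) (s (m * i).+1 + s (m * i + m.-1)%N + s (m * i.+1)%N).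
  apply/polyP => j; rewrite coef_poly coef_sum.
  under eq_bigr => i _ do rewrite !coefD !coef_poly.
  case: ltnP => lt_jN; last by rewrite big1 // => i _; rewrite !addr0.
  case: posnP => [-> /=|j_gt0].
    rewrite big1 => [|i _]; last by rewrite !addr0.
    by rewrite sigma'0.
  rewrite (@sigma'_triple m n) ?j_gt0 ?(leq_trans _ leN) // natr_sum /=.
  apply: eq_bigr => i _.
  by rewrite /= !natrD !(fun_if (fun d : nat => d%:R : rat)) !natrD.
apply: (log_deriv_prod _ (S := fun i => s (m * i).+1 + s (m * i + m.-1)%N + s (m * i.+1)%N)
   (F := fun i => (1 - 'X^((m * i).+1)) * (1 - 'X^(m * i + m.-1)) * (1 - 'X^(m * i.+1)))) => i.
by apply: log_derivM; [apply: log_derivM|]; apply: log_deriv_subXn; lia.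
Qed.

(** * The truncated exponential and the Bell polynomial *)

Definition exp_trunc (N : nat) (f : {poly rat}) : {poly rat} :=
  \sum_(k < N.+1) ((k`!)%:R)^-1 *: f ^+ k.

Lemma exp_trunc_coef0 N (f : {poly rat}) : f`_0 = 0 -> (exp_trunc N f)`_0 = 1.
Proof.
move=> f0; rewrite /exp_trunc coef_sum big_ord_recl /= invr1 scale1r coef1.
rewrite big1 ?addr0 // => i _.
by rewrite coefZ exprS coef0M f0 mul0r mulr0.
Qed.

(** Differentiation loses the top term of the truncated exponential; the defect x f' f^N / N! is
    divisible by X^(N+1), as X divides f. *)
Lemma log_deriv_exp_trunc N (f : {poly rat}) : f`_0 = 0 ->
  log_deriv N (- ('X * f^`())) (exp_trunc N f).
Proof.
move=> f0; rewrite /log_deriv mulrN opprK.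
have -> : (exp_trunc N f)^`() = f^`() * \sum_(k < N) ((k`!)%:R)^-1 *: f ^+ k.
  rewrite /exp_trunc linear_sum big_ord_recl /= derivZ derivC scaler0 add0r.
  rewrite mulr_sumr; apply: eq_bigr => i _; rewrite derivZ deriv_exp /=.
  rewrite -scalerAr -scaler_nat scalerA; congr (_ *: _).
  by rewrite factS natrM invfM mulrAC mulVf ?mul1r // Num.Theory.pnatr_eq0.
rewrite /exp_trunc big_ord_recr /= mulrDl -[X in eqmodX _ X _]addr0.
apply: eqmodXD; first by rewrite mulrA mulrC eqmodX_refl.
apply: eqmodX_sym; rewrite /eqmodX subr0 exprS mulrCA.
apply: dvdp_mul; first exact: dvdpp.
rewrite -scalerAl dvdpZr ?invr_eq0 ?Num.Theory.pnatr_eq0 -?lt0n ?fact_gt0 //.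
have Xf : 'X %| f.
  have := @coef_eqmodX 1 f 0; rewrite /eqmodX subr0; apply => -[|//] _.
  by rewrite f0 coef0.
by apply: dvdp_mulr; exact: dvdp_exp2r.
Qed.

Lemma exp_trunc_bell_f n m : (3 <= m)%N ->
  (exp_trunc n (bell_f n (dseq m)))`_n = (triple_prod m n.*2)`_n.
Proof.
move=> hm; set f := bell_f n (dseq m).
have coef_f i : f`_i = if (0 < i <= n)%N then dseq m i / (i`!)%:R else 0.
  rewrite /f /bell_f coef_sum; under eq_bigr => j _ do rewrite coefZ coefXn.
  case: ifP => [/andP[i_gt0 le_in]|not_i].
    rewrite (bigD1_seq i) ?mem_index_iota ?iota_uniq ?i_gt0 //= eqxx mulr1.
    by rewrite big1 ?addr0 // => j; rewrite eq_sym => /negPf->; rewrite mulr0.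
  rewrite big_nat big1 // => j hj; case: eqP => [eij|_]; last by rewrite mulr0.
  by rewrite eij -[(j <= n)%N]ltnS hj in not_i.
have f0 : f`_0 = 0 by rewrite coef_f.
apply: (@log_deriv_coef_inj n (sigma_poly m n)) => //.
- by rewrite coef_poly /= sigma'0.
- rewrite exp_trunc_coef0 //.
  rewrite -horner_coef0 horner_prod big1 // => i _.
  have factor0 d : (0 < d)%N -> (1 - 'X^d : {poly rat}).[0] = 1.
    by move=> d_gt0; rewrite !hornerE expr0n gtn_eqF // subr0.
  by rewrite !hornerM !factor0 ?mulr1 //; lia.
(* Since i d_i / i! = - sigma'_m(i), this is an exact equality of polynomials, both stopping at
   degree n. *)
- suff -> : sigma_poly m n = - ('X * f^`()) by exact: log_deriv_exp_trunc.
  apply/polyP => -[|i]; rewrite coefN coefXM coef_poly /= ?oppr0.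
    by rewrite sigma'0.
  rewrite coef_deriv coef_f /= ltnS; case: ltnP => _; last by rewrite mul0rn oppr0.
  rewrite /dseq /= factS natrM -mulrnAl -[_ *+ i.+1]mulr_natr.
  have nz k : (0 < k)%N -> k%:R != 0 :> rat by rewrite Num.Theory.pnatr_eq0 lt0n.
  have := nz i.+1 isT; have := nz _ (fact_gt0 i).
  by move: (i.+1%:R) (i`!%:R) => a b b0 a0; field; rewrite a0 b0.
by apply: log_deriv_triple_prod => //; nia.
Qed.

Local Close Scope ring_scope.

Theorem theorem3p1 (n m : nat) (hn : 0 < n) (hm : 3 <= m) :
  bellB n (dseq m) = ((n`!)%:R * (e_gn (m + 2) n)%:~R)%R.
Proof.
by rewrite /bellB -/(exp_trunc n _) exp_trunc_bell_f // triple_prod_coef.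
Qed.
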